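(* Let $f:\mathbb{C}\to\mathbb{C}$ be a non-constant polynomial and $c\in\mathbb{C}$. Then $\mathbb{C}\setminus\mathcal{K}_c$ is a connected set.
   Context: The sequence $(f_n)_{n\ge 0}$ is defined by $f_0(z)=z$, $f_1(z)=f(z)$, and $f_n(z)=f_{n-1}(z)f_{n-2}(z)+c$ for $n\ge 2$. The filled-in Julia set is $\mathcal{K}_c=\{z\in\mathbb{C}:\sup_{n\in\mathbb{N}}|f_n(z)|<+\infty\}$. *)

(* Defs.v *)
From HB Require Import structures.
From mathcomp Require Import all_boot all_order all_algebra.
From mathcomp Require Import all_classical all_reals all_analysis.
From mathcomp Require Import complex.

Set Implicit Arguments.
Unset Strict Implicit.
Unset Printing Implicit Defensive.

Import Order.TTheory GRing.Theory Num.Theory.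
Import numFieldNormedType.Exports.

Local Open Scope classical_set_scope.
Local Open Scope ring_scope.

Fixpoint fib_orbit (R : realType) (f : {poly R[i]}) (c : R[i]) (n : nat)
    (z : R[i]) {struct n} : R[i] :=
  match n with
  | 0 => z
  | 1 => f.[z]
  | (m.+1 as k).+1 => fib_orbit f c k z * fib_orbit f c m z + c
  end.

(* The norm `|w| of w : R[i] is itself an element of R[i]; Normc.normc w is
   the same modulus with values in R, i.e. `|w| = (Normc.normc w)%:C.
   MathComp-Analysis puts the norm topology of a numFieldType K on its alias
   K^o, so R[i]^o is the complex plane as a topological space. *)
Definition filled_julia (R : realType) (f : {poly R[i]}) (c : R[i]) :
    set (R[i]^o) :=
  [set z | (ereal_sup
     (range (fun n : nat => (Normc.normc (fib_orbit f c n z))%:E))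
     < +oo)%E].

(* Main.v *)
Require Import Defs.
From HB Require Import structures.
From mathcomp Require Import all_boot all_order all_algebra.
From mathcomp Require Import all_classical all_reals all_analysis.
From mathcomp Require Import complex ring lra.
Import Order.TTheory GRing.Theory Num.Theory.
Import numFieldNormedType.Exports.
Local Open Scope classical_set_scope.
Local Open Scope ring_scope.
Local Open Scope complex_scope.
Import Normc.

Set Implicit Arguments.
Unset Strict Implicit.
Unset Printing Implicit Defensive.

(** If two consecutive terms of an orbit have modulus at least [|c| + 2], the
    orbit escapes.  Looking at the first term exceeding all previous ones, this
    forces the orbits in the filled Julia set [K] to be bounded by one constant
    [M] independent of the point, so [K] is closed and bounded and its
    complement is open.  If the complement split into two separated parts, the
    one not containing the connected exterior of a large square would be a
    bounded open set whose boundary lies in [K]; there every [|f_n|] is at most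
    [M], so by the maximum principle it is at most [M] on the whole part, which
    then lies in [K]. *)

(** * Escape and uniform bounds for the recursion *)

Lemma fibonacci_escape (R : realFieldType) (C : R) (a : nat -> R) (n : nat) :
  0 <= C -> (forall m, a m.+1 * a m <= a m.+2 + C) ->
  C + 2 <= a n -> C + 2 <= a n.+1 -> forall k, k%:R <= a (n + k).+1.
Proof.
move=> C0 aC an an1 k.
(* Two consecutive terms enter the invariant: multiplying by a factor at least [C + 2] and losing
   [C] raises the lower bound by at least 1. *)
suff [_ h] : C + 2 <= a (n + k)%N /\ C + 2 + k%:R <= a (n + k).+1.
  by apply: le_trans h; lra.
elim: k => [|k [h1 h2]]; first by rewrite addn0; split; rewrite ?mulr0n; lra.
rewrite addnS -(natr1 k); have := ler0n R k.
move: (k%:R) h2 (aC (n + k)%N) => K h2 h3 K0.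
split; first lra.
nra.
Qed.

(** [B] depends on [C] alone, so it serves all orbits at once. The first four terms are bounded
    separately because the argument looks four indices back. *)
Lemma fibonacci_uniform_bound (R : realFieldType) (C : R) :
  0 <= C -> exists B : R, forall (a : nat -> R) (M : R),
  (forall m, 0 <= a m) ->
  (forall m, a m.+2 <= a m.+1 * a m + C) ->
  (forall m, a m.+1 * a m <= a m.+2 + C) ->
  (forall m, ~ (C + 2 <= a m /\ C + 2 <= a m.+1)) ->
  B <= M -> (forall m, (m < 4)%N -> a m <= M) -> forall m, a m <= M.
Proof.
move=> C0; pose r := C + 2.
(* Chosen to close the final chain: [M < r * a m.+2 + C] and [a m.+2 <= C + (r + C) * (r + C)]
   contradict [B <= M]. *)
exists (r * (C + (r + C) * (r + C)) + C) => a M a0 ub lb esc BM aM m.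
have [N] := ubnP m; elim: N m => // N IH m mN.
case: m mN => [|[|[|[|m]]]] mN; do 4?[exact: aM].
(* If [a m.+4] is the first term above [M], then [a m.+3 < r], so [a m.+2] is
   of order at least [M / r] and [a m.+1] of order at most 1 / [a m.+2]; hence
   [a m] is of order at least [a m.+2 ^+ 2], which exceeds [M]. *)
rewrite leNgt; apply/negP => am.
have r2 : 2 <= r by rewrite /r; lra.
have rM : r <= M by apply: le_trans BM; nra.
have a3 : a m.+3 < r.
  rewrite ltNge; apply/negP => a3.
  by case: (esc m.+3); split=> //; rewrite -/r; lra.
have am0 : a m <= M.
  by apply/IH/(@leq_trans m.+4); [exact: (leq_addl 3 m.+1)|exact: mN].
have h4 := ub m.+2; have h3 := lb m.+1; have h2 := ub m.
have p0 := a0 m; have p1 := a0 m.+1; have p2 := a0 m.+2; have p3 := a0 m.+3.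
clear IH mN esc a0 ub lb aM.
have M4 : M < r * a m.+2 + C by nra.
have e1 : a m.+2 * a m.+2 <= (r + C) * M + C * a m.+2.
  have : a m.+2 * a m.+2 <= a m.+2 * (a m.+1 * a m + C) by rewrite ler_wpM2l.
  nra.
(* This absorbs the additive [C]: [r * a m.+2 + C <= (r + C) * a m.+2]. A value below 1 would give
   [M < r + C], too small for [B <= M]. *)
have x1 : 1 <= a m.+2.
  rewrite leNgt; apply/negP => x1.
  have s4 : 2 <= (r + C) * (r + C) by nra.
  have : r * 1 < r * (C + (r + C) * (r + C)) by rewrite ltr_pM2l; lra.
  have : r * a m.+2 <= r * 1 by rewrite ler_wpM2l//; lra.
  lra.
have e2 : a m.+2 * a m.+2 <= a m.+2 * (C + (r + C) * (r + C)).
  have Mx : M <= (r + C) * a m.+2 by nra.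
  have : (r + C) * M <= (r + C) * ((r + C) * a m.+2).
    by rewrite ler_wpM2l//; lra.
  lra.
have e3 : a m.+2 <= C + (r + C) * (r + C) by rewrite ler_pM2l// in e2; lra.
have : r * a m.+2 <= r * (C + (r + C) * (r + C)).
  by rewrite ler_wpM2l//; lra.
lra.
Qed.

(** * Polynomials: continuity and local behaviour of the modulus *)

Lemma polynomial_continuous (K : numFieldType) (p : {poly K}) :
  continuous (fun z : K^o => p.[z] : K^o).
Proof.
elim/poly_ind: p => [|p a IH].
  rewrite (_ : (fun z => _) = fun=> 0); first exact: cst_continuous.
  by apply/funext => z; rewrite horner0.
rewrite (_ : (fun z => _) =
    ((fun z : K^o => p.[z] : K^o) \* id) \+ cst a); last first.
  by apply/funext => z; rewrite hornerMXaddC.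
move=> x; apply: continuousD; last exact: cst_continuous.
by apply: continuousM; [exact: IH|exact: cvg_id].
Qed.

Lemma polynomial_no_local_max (K : numClosedFieldType) (p : {poly K})
    (w : K) (U : set K^o) :
  (1 < size p)%N -> nbhs (w : K^o) U -> exists2 z, U z & `|p.[w]| < `|p.[z]|.
Proof.
move=> p1 Uw.
have [k [r]] := multiplicity_XsubC (p - p.[w]%:P) w.
have -> /= : p - p.[w]%:P != 0.
  by apply: contraTneq p1 => /subr0_eq ->; rewrite size_polyC; case: (_ != _).
rewrite /root => rw pE.
have k0 : (0 < k)%N.
  rewrite lt0n; apply: contraNneq rw => k0.
  move: (congr1 (horner^~ w) pE).
  by rewrite k0 expr0 mulr1 !hornerE subrr => <-.
have pz z : p.[z] = p.[w] + r.[z] * (z - w) ^+ k.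
  by move: (congr1 (horner^~ z) pE); rewrite !hornerE => <-; ring.
(* Moving from [w] in the direction [u] makes the leading correction term of
   [p] a positive multiple of [a], hence aligned with [p.[w]]. *)
pose a := if p.[w] == 0 then 1 else p.[w].
have a0 : a != 0 by rewrite /a; case: ifPn; rewrite ?oner_eq0.
have aE t : 0 <= t -> `|p.[w] + t * a| = `|p.[w]| + t * `|a|.
  move=> t0; rewrite /a; case: eqVneq => [->|_].
    by rewrite !add0r normr0 add0r normrM (ger0_norm t0).
  rewrite -{1}[p.[w]]mul1r -mulrDl normrM ger0_norm ?addr_ge0//.
  by rewrite mulrDl mul1r.
pose u := k.-root (a / r.[w]).
have uk : u ^+ k * r.[w] = a by rewrite rootCK// divfK.
have u0 : u != 0.
  by apply: contraNneq a0 => u0; rewrite -uk u0 expr0n gtn_eqF// mul0r.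
(* This closeness makes the error [(r.[w] - r.[z]) * (t * u) ^+ k] smaller than the main term [r.[w]
   * (t * u) ^+ k]. *)
have rcont : \forall z \near (w : K^o), `|r.[w] - r.[z]| < `|r.[w]|.
  have /cvgrPdist_lt := @polynomial_continuous K r w.
  by apply; rewrite normr_gt0.
have /nbhs_ballP[e /= e0 Ue] :
    nbhs (w : K^o) (U `&` [set z | `|r.[w] - r.[z]| < `|r.[w]|]).
  exact: filterI.
pose t := e / 2 / `|u|.
have t0 : 0 < t by rewrite !divr_gt0// normr_gt0.
have [] := Ue (w + t * u).
  rewrite -ball_normE /= opprD addrA subrr add0r normrN normrM (gtr0_norm t0).
  by rewrite divfK ?normr_eq0// ltr_pdivrMr// ltr_pMr// ltr1n.
set z := w + t * u => Uz rz; exists z => //.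
have -> : p.[z] = p.[w] + t ^+ k * a - (r.[w] - r.[z]) * (t * u) ^+ k.
  rewrite pz (_ : z - w = t * u); last by rewrite /z; ring.
  by rewrite -uk exprMn; ring.
apply: lt_le_trans (lerB_normD _ _).
rewrite aE ?exprn_ge0 ?ltW// normrN normrM -addrA ltrDl subr_gt0.
rewrite normrX normrM (gtr0_norm t0) -uk normrM normrX exprMn.
rewrite [X in _ < X]mulrA [X in _ < X]mulrC ltr_pM2r//.
by rewrite mulr_gt0// exprn_gt0// normr_gt0.
Qed.

(** * Modulus and topology of the complex plane *)

Lemma norm_normc (R : rcfType) (z : R[i]) : `|z| = (normc z)%:C.
Proof. by []. Qed.

Lemma normc_real (R : rcfType) (x : R) : normc (x%:C) = `|x|.
Proof. by rewrite /= expr0n/= addr0 sqrtr_sqr. Qed.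

(** Positive elements of [R[i]] are real in its partial order; this turns the [R[i]]-valued radii of
    [R[i]^o] into real ones. *)
Lemma gt0_complex_real (R : rcfType) (e : R[i]) :
  0 < e -> exists2 r : R, 0 < r & e = r%:C.
Proof. by case: e => a b; rewrite ltcE /= => /andP[/eqP -> a0]; exists a. Qed.

Lemma ler_dist_normc (R : rcfType) (x y : R[i]) :
  `|normc x - normc y| <= normc (x - y).
Proof.
have := ler_dist_dist x y.
by rewrite !norm_normc -rmorphB normc_real lecR.
Qed.

Lemma normc_continuous (R : realType) :
  continuous (fun z : R[i]^o => normc z).
Proof.
move=> x; apply/(@cvgrPdist_lt _ _ _ _ (nbhs_filter (x : R[i]^o))) => e e0.
apply/nbhs_ballP; exists e%:C => [|y] /=; first by rewrite ltcR.
rewrite -ball_normE /= norm_normc ltcR.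
by apply: le_lt_trans; exact: ler_dist_normc.
Qed.

Lemma real_complex_continuous (R : realType) :
  continuous (fun x : R => x%:C : R[i]^o).
Proof.
move=> x; apply/cvgrPdist_lt => _ /gt0_complex_real[e e0 ->].
apply/nbhs_ballP; exists e => // y.
by rewrite /ball_ /= -rmorphB norm_normc normc_real ltcR.
Qed.

Lemma complex_continuous (R : realType) :
  continuous (fun z : R * R => z.1 +i* z.2 : R[i]^o).
Proof.
rewrite (_ : (fun z => _) =
    (fun z => z.1%:C : R[i]^o) \+
    (fun z => ('i : R[i]^o) * (z.2%:C : R[i]^o))); last first.
  by apply/funext => -[x y]; apply/eqP; rewrite /= eq_complex /=; simpc.
move=> z; apply: continuousD.
  exact: (@continuous_comp _ _ _ fst (fun x : R => x%:C : R[i]^o) z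
    cvg_fst (@real_complex_continuous R _)).
apply: continuousM; first exact: cst_continuous.
exact: (@continuous_comp _ _ _ snd (fun x : R => x%:C : R[i]^o) z
  cvg_snd (@real_complex_continuous R _)).
Qed.

Lemma ler_abs_Re_normc (R : rcfType) (z : R[i]) : `|complex.Re z| <= normc z.
Proof. by rewrite -lecR -norm_normc normc_ge_Re. Qed.

Lemma ler_abs_Im_normc (R : rcfType) (z : R[i]) : `|complex.Im z| <= normc z.
Proof.
by case: z => x y; rewrite /= -sqrtr_sqr ler_wsqrtr// lerDr sqr_ge0.
Qed.

(** Heine-Borel carried over from [R * R]: [A] is closed in the image of a compact square. *)
Lemma closed_bounded_compact (R : realType) (A : set R[i]^o) (r : R) :
  closed A -> (forall z, A z -> normc z <= r) -> compact A.
Proof.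
move=> clA Ar; pose S := `[- r, r]%classic `*` `[- r, r]%classic : set (R * R).
have cS : compact [set (z.1 +i* z.2 : R[i]^o) | z in S].
  apply: continuous_compact; last first.
    by apply: compact_setX; exact: segment_compact.
  by apply: continuous_subspaceT; exact: complex_continuous.
apply: subclosed_compact clA cS _ => -[x y] Axy.
exists (x, y) => //; split; rewrite /= in_itv /= -ler_norml.
  exact: le_trans (ler_abs_Re_normc (x +i* y)) (Ar _ Axy).
exact: le_trans (ler_abs_Im_normc (x +i* y)) (Ar _ Axy).
Qed.

(** * Connected subsets of the plane *)

Lemma convex_connected (R : realType) (A : set R[i]^o) :
  (forall x y (t : R), A x -> A y -> 0 <= t <= 1 -> A (x + t%:C * (y - x))) ->
  connected A.
Proof.
move=> cA; have [->|/set0P[x0 Ax0]] := eqVneq A set0; first exact: connected0.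
pose seg y (t : R) : R[i]^o := x0 + t%:C * (y - x0).
have segc y : continuous (seg y).
  rewrite (_ : seg y =
      cst (x0 : R[i]^o) \+
      ((fun t => t%:C : R[i]^o) \* cst (y - x0 : R[i]^o)))//.
  move=> t; apply: continuousD; first exact: cst_continuous.
  by apply: continuousM; [exact: real_complex_continuous|exact: cst_continuous].
(* [A] is a union of segments that all contain [x0]. *)
rewrite (_ : A = \bigcup_(y in A) [set seg y t | t in `[0, 1]%classic]).
  apply: bigcup_connected => [|y Ay].
    exists x0 => y Ay; exists 0; first by rewrite /= in_itv /= lexx ler01.
    by rewrite /seg mul0r addr0.
  apply: connected_continuous_connected; first exact: segment_connected.
  exact: continuous_subspaceT.
apply/seteqP; split=> [y Ay|_ [y Ay] [t t01 <-]].
  exists y => //; exists 1; first by rewrite /= in_itv /= lexx ler01.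
  by rewrite /seg mul1r addrC subrK.
by apply: cA => //; move: t01; rewrite /= in_itv.
Qed.

(** The factor [u] rotates: 1, ['i], -1 and [-'i] give [Re z > r], [Im z < -r], [Re z < -r] and
    [Im z > r]. *)
Definition half_plane (R : rcfType) (u : R[i]) (r : R) : set R[i]^o :=
  [set z | r < complex.Re (u * z)].

Lemma half_plane_connected (R : realType) (u : R[i]) (r : R) :
  connected (half_plane u r).
Proof.
apply: convex_connected => x y t; rewrite /half_plane /= => ux uy /andP[t0 t1].
rewrite mulrDr raddfD /= mulrCA mulrBr.
move: (u * x) (u * y) ux uy => [a b] [a' b'] /= ux uy; rewrite mul0r subr0.
by have [aa'|aa'] := lerP a a'; nra.
Qed.

(** The set is the union of four half-planes, and neighbouring ones meet beyond a corner of the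
    square. *)
Lemma square_complement_connected (R : realType) (r : R) : 0 <= r ->
  connected [set z : R[i]^o | r < `|complex.Re z| \/ r < `|complex.Im z|].
Proof.
move=> r0; pose H := fun u : R[i] => half_plane u r.
rewrite (_ : [set z | _] = H 1 `|` H 'i `|` H (-1) `|` H (-'i)).
  have r1 : r < r + 1 by rewrite ltrDl.
  do 3?[apply: connectedU; last exact: half_plane_connected].
  - exists ((- (r + 1)) +i* (r + 1)); rewrite /H /half_plane.
    by split=> /=; simpc; [right; lra|lra].
  - exists ((- (r + 1)) +i* (- (r + 1))); rewrite /H /half_plane.
    by split=> /=; simpc; [right; lra|lra].
  - exists ((r + 1) +i* (- (r + 1))); rewrite /H /half_plane.
    by split=> /=; simpc; lra.
  - exact: half_plane_connected.
apply/seteqP; rewrite /H /half_plane; split=> -[x y] /=; simpc;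
  rewrite !lter_normr.
  by case=> /orP[] h; [do 3!left|left; right|right|do 2!left; right].
by case=> [[[]|]|] ->; rewrite ?orbT; [left|right|left|right].
Qed.

(** * Growth of polynomials *)

Lemma normc_nneg (R : rcfType) (z : R[i]) : 0 <= normc z.
Proof. by case: z => x y; exact: sqrtr_ge0. Qed.

Lemma horner_bounded (R : rcfType) (p : {poly R[i]}) (r : R) :
  exists M : R, forall z, normc z <= r -> normc p.[z] <= M.
Proof.
elim/poly_ind: p => [|p a [M IH]].
  by exists 0 => z _; rewrite horner0 normc0.
exists (`|M| * `|r| + normc a) => z zr; rewrite hornerMXaddC.
apply: le_trans (le_normcD _ _) _; rewrite lerD2r normcM.
apply: ler_pM; rewrite ?normc_nneg//.
  exact: le_trans (IH _ zr) (ler_norm _).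
exact: le_trans zr (ler_norm _).
Qed.

(** In [p * 'X + a%:P], the factor [p] is either nonconstant, hence of modulus at least 1 far out,
    or a nonzero constant; both make the product grow linearly at least. *)
Lemma horner_unbounded (R : rcfType) (p : {poly R[i]}) (M : R) :
  (1 < size p)%N -> exists r : R, forall z, r <= normc z -> M <= normc p.[z].
Proof.
elim/poly_ind: p M => [|p a IH] M; first by rewrite size_poly0.
have lb z : normc p.[z] * normc z - normc a <= normc (p * 'X + a%:P).[z].
  rewrite hornerMXaddC -normcM lerBlDr -(normcN a).
  by apply: le_trans (le_normcD _ _); rewrite addrK.
rewrite size_MXaddC; case: ifP => // /negbT; rewrite negb_and ltnS => _ p0.
have [p1|p1] := ltnP 1 (size p).
  have [r rP] := IH 1 p1; exists (Num.max r (M + normc a)) => z.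
  rewrite ge_max => /andP[/rP rz Mz]; apply: le_trans (lb z).
  by rewrite lerBrDr (le_trans Mz)// ler_peMl ?normc_nneg.
have pb := size1_polyC p1; set b := p`_0 in pb.
have b0 : 0 < normc b.
  rewrite lt_def normc_nneg andbT; apply: contraTneq p0 => /eq0_normc b0.
  by rewrite pb b0 size_poly0.
exists ((M + normc a) / normc b) => z; rewrite ler_pdivrMr// => Mz.
by apply: le_trans (lb z); rewrite pb hornerC lerBrDr mulrC.
Qed.

(** * Orbit polynomials and the filled Julia set *)

Fixpoint fib_poly (R : rcfType) (f : {poly R[i]}) (c : R[i]) (n : nat)
    {struct n} : {poly R[i]} :=
  match n with
  | 0 => 'X
  | 1 => f
  | (m.+1 as k).+1 => fib_poly f c k * fib_poly f c m + c%:P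
  end.

Lemma horner_fib_poly (R : realType) (f : {poly R[i]}) (c : R[i]) n z :
  (fib_poly f c n).[z] = fib_orbit f c n z.
Proof.
suff [] : (fib_poly f c n).[z] = fib_orbit f c n z /\
  (fib_poly f c n.+1).[z] = fib_orbit f c n.+1 z by [].
elim: n => [|n [IH1 IH2]]; first by rewrite /= hornerX.
split=> //.
rewrite -[fib_poly f c n.+2]/(fib_poly f c n.+1 * fib_poly f c n + c%:P).
by rewrite !hornerE IH1 IH2.
Qed.

(** Degrees add along the recursion and adding [c] cannot lower a positive degree; the maximum
    principle thus applies to every iterate. *)
Lemma size_fib_poly (R : rcfType) (f : {poly R[i]}) (c : R[i]) n :
  (1 < size f)%N -> (1 < size (fib_poly f c n))%N.
Proof.
move=> f1.
suff [] : (1 < size (fib_poly f c n) /\ 1 < size (fib_poly f c n.+1))%N by [].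
elim: n => [|n [IH1 IH2]]; first by rewrite /= size_polyX.
split=> //.
rewrite -[fib_poly f c n.+2]/(fib_poly f c n.+1 * fib_poly f c n + c%:P).
have h : (1 < size (fib_poly f c n.+1 * fib_poly f c n)%R)%N.
  rewrite size_mul -?size_poly_gt0 ?(ltnW IH1) ?(ltnW IH2)//.
  case: (size _) IH2 => // -[//|m] _; case: (size _) IH1 => // -[//|k] _.
  by rewrite addSn /= addnS.
by rewrite size_polyDl// size_polyC; apply: leq_trans h; case: (_ != _).
Qed.

Lemma filled_juliaP (R : realType) (f : {poly R[i]}) (c z : R[i]) :
  filled_julia f c z <-> exists M : R, forall n, normc (fib_orbit f c n z) <= M.
Proof.
split=> [|[M Mz]]; rewrite /filled_julia /=; last first.
  apply: (@le_lt_trans _ _ M%:E); last exact: ltry.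
  by apply: ge_ereal_sup => _ [n _ <-]; rewrite lee_fin.
have ub n : ((normc (fib_orbit f c n z))%:E <=
    ereal_sup (range (fun n => (normc (fib_orbit f c n z))%:E)))%E.
  by apply: ereal_sup_ubound; exists n.
case: ereal_sup ub => [M| |] ub // _; last by have := ub 0%N.
by exists M => n; have := ub n; rewrite lee_fin.
Qed.

Lemma filled_julia_uniformly_bounded (R : realType) (f : {poly R[i]})
    (c : R[i]) :
  (1 < size f)%N -> exists M : R,
  forall z, filled_julia f c z -> forall n, normc (fib_orbit f c n z) <= M.
Proof.
move=> f1; pose C := normc c; have C0 : 0 <= C by exact: normc_nneg.
have [r rP] := horner_unbounded (C + 2) f1.
(* A point of modulus at least [r'] has its first two terms at least [C + 2] and escapes, so the set
   lies in this disc, where the first four polynomials are bounded. *)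
pose r' := Num.max (C + 2) r.
have [B BP] := fibonacci_uniform_bound C0.
have [M0 M0P] := horner_bounded (fib_poly f c 0) r'.
have [M1 M1P] := horner_bounded (fib_poly f c 1) r'.
have [M2 M2P] := horner_bounded (fib_poly f c 2) r'.
have [M3 M3P] := horner_bounded (fib_poly f c 3) r'.
exists (Num.max B (Num.max (Num.max M0 M1) (Num.max M2 M3))).
move=> z /filled_juliaP[M MP].
pose a n := normc (fib_orbit f c n z).
have ub m : a m.+2 <= a m.+1 * a m + C by rewrite /a -normcM; exact: le_normcD.
have lb m : a m.+1 * a m <= a m.+2 + C.
  rewrite /a -normcM /C -(normcN c); apply: le_trans (le_normcD _ _).
  by rewrite addrK.
have esc m : ~ (C + 2 <= a m /\ C + 2 <= a m.+1).
  case=> am am1; have := fibonacci_escape C0 lb am am1.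
  (* Linear growth passes [M] at an index given by the Archimedean property. *)
  move=> /(_ (Num.bound `|M|)); apply/negP; rewrite -ltNge.
  apply: le_lt_trans (MP _) _.
  exact: le_lt_trans (ler_norm _) (archi_boundP (normr_ge0 M)).
have zr : normc z <= r'.
  rewrite leNgt gt_max; apply/negP => /andP[/ltW z1 /ltW z2].
  by apply: (esc 0%N); split=> //; apply: rP.
apply: BP => //.
- by move=> m; apply: normc_nneg.
- by rewrite le_max lexx.
- move=> [|[|[|[|//]]]] _; rewrite /a -horner_fib_poly !le_max.
  + by rewrite M0P ?orbT.
  + by rewrite M1P ?orbT.
  + by rewrite M2P ?orbT.
  + by rewrite M3P ?orbT.
Qed.

Lemma normc_horner_continuous (R : realType) (p : {poly R[i]}) :
  continuous (fun z : R[i]^o => normc p.[z]).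
Proof.
move=> z; exact: (@continuous_comp R[i]^o R[i]^o R
  (fun z => p.[z]) (fun z => normc z) z
  (@polynomial_continuous _ _ _) (@normc_continuous _ _)).
Qed.

(** The uniform bound makes the set an intersection of closed sublevel sets; pointwise bounds would
    only give a union of such intersections. *)
Lemma filled_julia_closed (R : realType) (f : {poly R[i]}) (c : R[i]) :
  (1 < size f)%N -> closed (filled_julia f c).
Proof.
move=> f1; have [M MP] := filled_julia_uniformly_bounded c f1.
rewrite (_ : filled_julia f c =
    \bigcap_n [set z | normc (fib_poly f c n).[z] <= M]).
  apply: closed_bigI => n _.
  apply: (@preimage_closed R[i]^o R (fun z => normc (fib_poly f c n).[z])
    [set x | x <= M]); last exact: closed_le.
  by move=> z _; exact: normc_horner_continuous.
apply/seteqP; split=> [z Kz n _ /=|z Kz].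
  by rewrite horner_fib_poly; exact: MP.
by apply/filled_juliaP; exists M => n; rewrite -horner_fib_poly; exact: Kz.
Qed.

(** * Maximum principle on bounded open sets *)

Lemma polynomial_maximum_principle (R : realType) (p : {poly R[i]})
    (V : set R[i]^o) (M r : R) :
  (1 < size p)%N -> open V -> (forall z, V z -> normc z <= r) ->
  (forall z, closure V z -> ~ V z -> normc p.[z] <= M) ->
  forall z, V z -> normc p.[z] <= M.
Proof.
move=> p1 oV Vr bM z Vz.
have clr : closed [set x : R[i]^o | normc x <= r].
  apply: (@preimage_closed R[i]^o R (fun z => normc z) [set x | x <= r]).
    by move=> ? _; exact: normc_continuous.
  exact: closed_le.
have cV : compact (closure V).
  apply: (@closed_bounded_compact _ _ r); first exact: closed_closure.
  by move=> x /(closureS Vr)/clr.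
have Vcz : closure V z by exact: subset_closure.
have [w] := @compact_EVT_max R[i]^o R (fun z => normc p.[z]) _
  (ex_intro _ z Vcz) cV
  (continuous_subspaceT (@normc_horner_continuous _ p)).
rewrite inE => Vw wmax.
apply: le_trans (wmax z _) _; first by rewrite inE.
(* A maximiser outside [V] is a boundary point, covered by [bM]; inside [V] it would be a local
   maximum of the modulus. *)
have [Vw'|] := pselect (V w); last exact: bM.
have [x Vx] := polynomial_no_local_max p1 (open_nbhs_nbhs (conj oV Vw')).
have xw : normc p.[x] <= normc p.[w].
  by apply: wmax; rewrite inE; exact: subset_closure.
move=> wx; have : normc p.[w] < normc p.[x] by rewrite -ltcR.
by rewrite ltNge xw.
Qed.

(** * Connectedness of the complement *)

Theorem proposition2p6 (R : realType) (f : {poly R[i]}) (c : R[i])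
  (f_nonconstant : (1 < size f)%N) :
  connected (~` filled_julia f c).
Proof.
set K := filled_julia f c.
have [M MP] := filled_julia_uniformly_bounded c f_nonconstant.
have oK : open (~` K) by apply: closed_openC; exact: filled_julia_closed.
(* The term of index 0 is [z] itself, so [M] also bounds the points of [K]; the absolute value
   ensures [0 <= r]. *)
pose r := `|M|.
pose S := [set z : R[i]^o | r < `|complex.Re z| \/ r < `|complex.Im z|].
have SK : S `<=` ~` K.
  move=> z Sz /MP/(_ 0%N)/= zM.
  have zr : normc z <= r by exact: le_trans zM (ler_norm _).
  by case: Sz; apply/negP; rewrite -leNgt; apply: le_trans zr;
    [exact: ler_abs_Re_normc|exact: ler_abs_Im_normc].
have sep (A B : set R[i]^o) :
    ~` K = A `|` B -> separated A B -> S `<=` A -> B = set0.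
  move=> KAB [AB BA] SA; apply/seteqP; split=> // z Bz.
  have oB : open B.
    rewrite (_ : B = ~` K `&` ~` closure A).
      by apply: openI => //; apply: closed_openC; exact: closed_closure.
    apply/seteqP; split=> [x Bx|x []].
      split; first by rewrite KAB; right.
      by move=> Ax; have : (closure A `&` B) x by []; rewrite AB.
    by rewrite KAB => -[/subset_closure//|].
  have bB x : B x -> normc x <= r + r.
    move=> Bx; suff : `|complex.Re x| <= r /\ `|complex.Im x| <= r.
      case: x {Bx} => a b /= [ar br].
      apply: le_trans (_ : `|a| + `|b| <= _); last exact: lerD.
      rewrite -(ler_sqr) ?nnegrE ?sqrtr_ge0 ?addr_ge0//.
      rewrite sqr_sqrtr ?addr_ge0 ?sqr_ge0//.
      rewrite -(real_normK (num_real a)) -(real_normK (num_real b)).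
      by rewrite sqrrD lerD2r lerDl mulrn_wge0// mulr_ge0.
    have nS : ~ S x.
      move=> /SA/subset_closure Ax; have : (closure A `&` B) x by [].
      by rewrite AB.
    by split; rewrite leNgt; apply/negP => h; apply: nS; [left|right].
  have Kz : K z.
    apply/filled_juliaP; exists M => n; rewrite -horner_fib_poly.
    have fn1 := size_fib_poly c n f_nonconstant.
    apply: (polynomial_maximum_principle fn1 oB bB) => // w Bw nBw.
    (* A boundary point of [B] outside [K] would lie in [A], against separation. *)
    rewrite horner_fib_poly; apply: MP; apply: contrapT => Kw.
    have : (A `|` B) w by rewrite -KAB.
    case=> // Aw; have : (A `&` closure B) w by [].
    by rewrite BA.
  by have : (~` K) z by rewrite KAB; right.
apply/connectedP => E [E0 KE sE].
have r0 : 0 <= r by exact: normr_ge0.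
have := connected_subset sE _ (square_complement_connected r0).
(* The connected set [S] lies in one of the two parts, and [sep] empties the other. *)
rewrite -KE => /(_ SK)[SE|SE].
  by have [z] := E0 true; have -> := sep _ _ KE sE SE.
have [z] := E0 false.
have -> // := sep (E true) (E false) _ _ SE; first by rewrite KE setUC.
by rewrite separatedC.
Qed.
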